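(* There exists a constant $\theta>0$ such that for all integers $n\ge 3$ and all integers $\xi$ with $1\le \xi\le \frac{n}{\log n}$, the largest eigenvalue $\beta(\xi)$ of $M(\xi)$ satisfies $$\beta(\xi)\le 1-\theta\left(\frac{\xi}{n}\right)^{4/3}.$$
   Context: For integers $n\ge 3$ and $\xi$, $M(\xi)$ is the real symmetric $n\times n$ matrix with rows and columns indexed by $0,1,\dots,n-1$, with diagonal entries $\frac12\cos\left(\frac{2\pi\xi j}{n}\right)$ for $0\le j\le n-1$, entries $\frac14$ on the superdiagonal and the subdiagonal and in the upper right and lower left corners, and all other entries $0$. Here $\log$ is the natural logarithm. *)

(* Defs.v *)
From mathcomp Require Import all_boot all_order all_algebra.
From mathcomp Require Import all_classical all_reals all_analysis.

Set Implicit Arguments.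
Unset Strict Implicit.
Unset Printing Implicit Defensive.

Import Order.TTheory GRing.Theory Num.Theory.
Local Open Scope ring_scope.

(* Intended for [3 <= n], where the corner positions are disjoint from the
   diagonals next to the main one. *)
Definition Mxi (R : realType) (n : nat) (xi : int) : 'M[R]_n :=
  \matrix_(i < n, j < n)
    if i == j then cos (2 * pi * xi%:~R * (j : nat)%:R / n%:R) / 2
    else if [|| (j : nat) == i.+1, (i : nat) == j.+1,
                ((i : nat) == 0%N) && ((j : nat) == n.-1)
              | ((i : nat) == n.-1) && ((j : nat) == 0%N)]
         then 1 / 4
         else 0.

Definition is_largest_eigenvalue (R : realType) (n : nat) (A : 'M[R]_n)
    (b : R) : Prop :=
  eigenvalue A b /\ (forall a : R, eigenvalue A a -> a <= b).

(* Main.v *)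
(** For an eigenvector [v] of norm 1 with eigenvalue [b], put [alpha = xi / n],
    [c_j = cos (2 pi alpha j)], [s_j = sin (2 pi alpha j)],
    [A = sum (1 - c_j) v_j^2] and [D = sum (v_j - v_(j+1))^2], indices being
    cyclic; then [1 - b = A / 2 + D / 4].  The discrete uncertainty principle
    comes from the identity
      [cos (pi alpha) (s_(j+1) - s_j) = sin (pi alpha) (c_j + c_(j+1))].
    Weighted by [v_j v_(j+1)] and summed, its left side is at most [A + 2 D]
    (summation by parts, then AM-GM), and its right side is at least
    [sin (pi alpha) (2 - 3 A - 3 D)].  Hence [1 - b >= sin (pi alpha) / 10].
    Finally [alpha <= 1 / ln 3 < 1], so [sin (pi alpha)] is at least a constant
    times [alpha], which is at least [alpha `^ (4 / 3)]: the exponent 4/3 could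
    be replaced by 1. *)
Require Import Defs.
From mathcomp Require Import all_boot all_order all_algebra.
From mathcomp Require Import all_classical all_reals all_analysis.
From mathcomp Require Import complex zify ring lra.

Set Implicit Arguments.
Unset Strict Implicit.
Unset Printing Implicit Defensive.

Import Order.TTheory GRing.Theory Num.Theory.
Import numFieldNormedType.Exports.
Local Open Scope ring_scope.

(** * Largest eigenvalues of real symmetric matrices *)

(** Induction on the size: dividing by ['X - a] removes only the root [a], which is then compared
    with the largest root of the quotient, if there is one. *)
Lemma max_root_exists (R : realFieldType) (p : {poly R}) (a : R) :
  p != 0 -> root p a -> exists2 b, root p b & forall c, root p c -> c <= b.
Proof.
have [m] := ubnP (size p); elim: m p a => // m IHm p a szp p0 pa.
have /factor_theorem[q pE] := pa.
have q0 : q != 0 by apply: contraNneq p0 => q0; rewrite pE q0 mul0r.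
have szq : (size q < m)%N.
  have : (0 < size q)%N by rewrite size_poly_gt0.
  by move: szp; rewrite pE size_Mmonic ?monicXsubC // size_XsubC addn2 ltnS;
    case: (size q) => //= k /ltnW; rewrite ltnS.
have rootE c : root p c = root q c || (c == a).
  by rewrite pE rootM root_XsubC.
have [[d qd]|noroot] := pselect (exists d, root q d).
  have [b qb maxb] := IHm q d szq q0 qd.
  exists (Num.max a b).
    by rewrite rootE; case: (leP a b) => _; rewrite ?qb ?eqxx ?orbT.
  move=> c; rewrite rootE le_max => /orP[/maxb ->|/eqP ->]; rewrite ?orbT //.
  by rewrite lexx.
exists a => // c; rewrite rootE => /orP[qc|/eqP ->//].
by case: noroot; exists c.
Qed.

Lemma row_sqr_eq0 (R : realDomainType) n (v : 'rV[R]_n) :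
  (\sum_j v 0 j ^+ 2 == 0) = (v == 0).
Proof.
apply/eqP/eqP => [s0|->]; last by rewrite big1 // => j _; rewrite mxE expr0n.
apply/rowP => j; rewrite mxE; apply/eqP; rewrite -sqrf_eq0.
by apply/eqP; apply: (psumr_eq0P _ s0) => // i _; exact: sqr_ge0.
Qed.

(* A complex eigenvector [a + i b] of [A] with eigenvalue [p + i q] satisfies
   [q (|a|^2 + |b|^2) = 0] by symmetry, so that [q = 0]. *)
Lemma sym_mx_eigenvalue (R : rcfType) n (A : 'M[R]_n) :
  (0 < n)%N -> A^T = A -> exists a, eigenvalue A a.
Proof.
move=> n0 symA; pose B := map_mx (real_complex R) A.
have /closed_rootP[z] : size (char_poly B) != 1%N.
  by rewrite size_char_poly; case: n n0 {A symA B}.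
rewrite -eigenvalue_root_char => /eigenvalueP[v vB v0].
pose a := map_mx (@complex.Re R) v; pose b := map_mx (@complex.Im R) v.
have eigE j : v 0 j * z = \sum_i v 0 i * (A i j)%:C%C.
  have := congr1 (fun w : 'rV_n => w 0 j) vB; rewrite !mxE mulrC => <-.
  by apply: eq_bigr => i _; rewrite !mxE.
have ReE (w : R[i]) (x : R) : complex.Re (w * x%:C%C) = complex.Re w * x.
  by case: w => p q /=; ring.
have ImE (w : R[i]) (x : R) : complex.Im (w * x%:C%C) = complex.Im w * x.
  by case: w => p q /=; ring.
have ReS (F : 'I_n -> R[i]) : complex.Re (\sum_i F i) = \sum_i complex.Re (F i).
  by apply: (big_morph (@complex.Re R)) => // -[? ?] [].
have ImS (F : 'I_n -> R[i]) : complex.Im (\sum_i F i) = \sum_i complex.Im (F i).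
  by apply: (big_morph (@complex.Im R)) => // -[? ?] [].
pose p := complex.Re z; pose q := complex.Im z.
have aA : a *m A = p *: a - q *: b.
  apply/rowP => j; rewrite !mxE.
  have := congr1 (@complex.Re R) (eigE j); rewrite ReS.
  under [in X in _ = X -> _]eq_bigr do rewrite ReE.
  under [in X in _ -> X = _]eq_bigr do rewrite mxE.
  move=> <-; rewrite /p /q; case: (v 0 j) (z) => x y [s t] /=; ring.
have bA : b *m A = p *: b + q *: a.
  apply/rowP => j; rewrite !mxE.
  have := congr1 (@complex.Im R) (eigE j); rewrite ImS.
  under [in X in _ = X -> _]eq_bigr do rewrite ImE.
  under [in X in _ -> X = _]eq_bigr do rewrite mxE.
  move=> <-; rewrite /p /q; case: (v 0 j) (z) => x y [s t] /=; ring.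
(* Expanding both sides, the terms in [p] cancel and [- q |b|^2 = q |a|^2] remains. *)
have : (a *m A *m b^T) = (b *m A *m a^T)^T.
  by rewrite !trmx_mul trmxK symA mulmxA.
rewrite aA bA mulmxBl mulmxDl -!scalemxAl linearD /= !linearZ /= !trmx_mul.
rewrite !trmxK => /addrI/eqP; rewrite eq_sym scalerN -addr_eq0.
rewrite -scalerDr scaler_eq0 => /orP[/eqP q0|/eqP/matrixP/(_ 0 0)].
  (* With [q = 0], both [a] and [b] satisfy the eigenvector equation for [p], and one of them is
     nonzero. *)
  move: aA bA; rewrite q0 !scale0r subr0 addr0 => aA bA.
  have [a0|a0] := eqVneq a 0; last by exists p; apply/eigenvalueP; exists a.
  exists p; apply/eigenvalueP; exists b => //.
  apply: contraNneq v0 => b0; apply/eqP/rowP => j.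
  apply/eqP; rewrite mxE eq_complex /=.
  move/rowP/(_ j): a0; move/rowP/(_ j): b0; rewrite !mxE => -> ->.
  by rewrite eqxx.
rewrite !mxE => /eqP.
under eq_bigr do rewrite [X in _ * X]mxE -expr2.
under [X in _ + X]eq_bigr do rewrite [X in _ * X]mxE -expr2.
rewrite paddr_eq0 ?sumr_ge0 //; try by move=> i _; exact: sqr_ge0.
rewrite !row_sqr_eq0 => /andP[/eqP a0 /eqP b0].
case/eqP: v0; apply/rowP => j; apply/eqP; rewrite mxE eq_complex /=.
move/rowP/(_ j): a0; move/rowP/(_ j): b0; rewrite !mxE => -> ->.
by rewrite eqxx.
Qed.

Lemma sym_mx_largest_eigenvalue (R : realType) n (A : 'M[R]_n) :
  (0 < n)%N -> A^T = A -> exists b, is_largest_eigenvalue A b.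
Proof.
move=> n0 symA; have [a] := sym_mx_eigenvalue n0 symA.
rewrite eigenvalue_root_char => /max_root_exists[|b rb maxb].
  exact/monic_neq0/char_poly_monic.
exists b; split; first by rewrite eigenvalue_root_char.
by move=> c; rewrite eigenvalue_root_char; exact: maxb.
Qed.

(** * Numerical bounds on e and on the sine *)

(** Gives [1 < ln 3], which keeps [pi xi / n] a fixed distance below [pi]. *)
Lemma expR1_lt3 (R : realType) : expR 1 < 3 :> R.
Proof.
have : (5 / 6) ^+ 6 <= expR (- 1) :> R.
  (* 6 is the least [n] such that [(n / (n - 1)) ^+ n < 3]. *)
  have -> : - 1 = 6%:R * (- 6^-1) :> R by field.
  rewrite expRM_natl; apply: lerXn2r; rewrite ?nnegrE ?expR_ge0 //.
  by have := expR_ge1Dx (- 6^-1 : R); lra.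
have := expRxMexpNx_1 (1 : R); have := expR_gt0 (1 : R).
by move: (expR 1) (expR (- 1)) => x y; nra.
Qed.

(* [sin x = 2 sin (x / 2) cos (x / 2)], and [cos t >= cos (a / 2)] for
   [0 <= t <= x / 2]. *)
Lemma sin_ge_lin (R : realType) (a x : R) :
  0 <= x <= a -> a < pi -> cos (a / 2) ^+ 2 * x <= sin x.
Proof.
move=> /andP[x0 xa] api; have p0 := pi_gt0 R.
have k0 : 0 < cos (a / 2) by apply: cos_gt0_pihalf; lra.
have cosge t : 0 <= t <= x / 2 -> cos (a / 2) <= cos t.
  move=> /andP[t0 tx]; rewrite leNgt ltr_cos ?in_itv /= -?leNgt;
    [lra|apply/andP; split; lra..].
have [c cx] : exists2 c, c \in `[0, x / 2] &
    sin (x / 2) - sin 0 = cos c * (x / 2 - 0).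
  apply: (@MVT_segment _ _ cos); first lra.
  by apply: continuous_subspaceT; exact: continuous_sin.
rewrite sin0 !subr0 in_itv /= in cx * => sE.
have := cosge _ cx; have := cosge (x / 2); rewrite lexx divr_ge0 // => /(_ isT).
have -> : sin x = 2 * (sin (x / 2) * cos (x / 2)).
  have -> : sin x = sin (x / 2 + x / 2) by congr sin; field.
  by rewrite sinD; ring.
rewrite sE => h1 h2.
have -> : 2 * (cos c * (x / 2) * cos (x / 2)) = cos c * cos (x / 2) * x.
  by field.
by rewrite ler_wpM2r // expr2 ler_pM // ltW.
Qed.

(** * The discrete uncertainty principle *)

(* Applied with [f] the cyclic shift, [kappa = cos (pi alpha)] and
   [tau = sin (pi alpha)]. *)
Lemma spectral_gap (R : realFieldType) (I : finType) (f : I -> I)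
    (c s v : I -> R) (kappa tau : R) :
  injective f -> (forall i, c i ^+ 2 + s i ^+ 2 = 1) ->
  kappa ^+ 2 + tau ^+ 2 = 1 -> 0 <= tau ->
  (forall i, kappa * (s (f i) - s i) = tau * (c i + c (f i))) ->
  \sum_i (c i * v i ^+ 2 + v i * v (f i)) / 2
    <= (1 - tau / 10) * \sum_i v i ^+ 2.
Proof.
move=> injf cs1 kt1 t0 comm.
have shift (F : I -> R) : \sum_i F (f i) = \sum_i F i.
  by rewrite [RHS](reindex_inj injf).
set Q := \sum_i v i ^+ 2.
pose A := \sum_i (1 - c i) * v i ^+ 2.
pose D := \sum_i (v i - v (f i)) ^+ 2.
have vvE : \sum_i v i * v (f i) = Q - D / 2.
  have -> : D = \sum_i v i ^+ 2 - 2 * (\sum_i v i * v (f i))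
      + \sum_i v (f i) ^+ 2.
    rewrite mulr_sumr -sumrB -big_split /=.
    by apply: eq_bigr => i _; ring.
  by rewrite (shift (fun i => v i ^+ 2)) -/Q; field.
have cvE : \sum_i c i * v i ^+ 2 = Q - A.
  by rewrite /Q /A -sumrB; apply: eq_bigr => i _; ring.
rewrite -mulr_suml big_split /= vvE cvE.
have c_le1 i : -1 <= c i <= 1 by have := cs1 i; nra.
have A0 : 0 <= A.
  apply: sumr_ge0 => i _; rewrite mulr_ge0 ?sqr_ge0 //.
  by have := c_le1 i; lra.
have D0 : 0 <= D by apply: sumr_ge0 => i _; exact: sqr_ge0.
have upper : \sum_i kappa * (s (f i) - s i) * (v i * v (f i)) <= A + 2 * D.
  (* Summation by parts: shifting the index in the [s i] terms moves the difference from [s] to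
     [v]. *)
  have -> : \sum_i kappa * (s (f i) - s i) * (v i * v (f i)) =
      \sum_i kappa * s (f i) * v (f i) * (v i - v (f (f i))).
    pose F i := kappa * s i * (v i * v (f i)).
    transitivity (\sum_i (kappa * s (f i) * (v i * v (f i)) - F (f i))).
      rewrite sumrB shift -sumrB /F; apply: eq_bigr => i _; ring.
    by apply: eq_bigr => i _; rewrite /F; ring.
  (* The two copies of [D] are taken at [i] and at [f i], so that the bound holds term by term. *)
  have -> : A + 2 * D = \sum_i ((1 - c (f i)) * v (f i) ^+ 2
     + (v i - v (f i)) ^+ 2 + (v (f i) - v (f (f i))) ^+ 2).
    rewrite !big_split /= (shift (fun i => (1 - c i) * v i ^+ 2)).
    by rewrite (shift (fun i => (v i - v (f i)) ^+ 2)) -/A -/D; ring.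
  apply: ler_sum => i _.
  move: (cs1 (f i)) (c_le1 (f i)).
  move: (c _) (s _) (v i) (v (f i)) (v (f (f i))) => C S x y z CS C1.
  have k1 : kappa ^+ 2 <= 1 by nra.
  (* From [S^2 = (1 - C) (1 + C) <= 2 (1 - C)]. *)
  have h1 : (kappa * S * y) ^+ 2 <= 2 * ((1 - C) * y ^+ 2).
    have : (kappa * S * y) ^+ 2 <= S ^+ 2 * y ^+ 2.
      rewrite exprMn (exprMn _ kappa) ler_wpM2r ?sqr_ge0 //.
      by rewrite ler_piMl ?sqr_ge0.
    have -> : S ^+ 2 = 1 - C ^+ 2 by rewrite -CS addrAC subrr add0r.
    have : 0 <= (1 - C) ^+ 2 * y ^+ 2 by rewrite -exprMn sqr_ge0.
    lra.
  (* AM-GM on the product of [kappa S y] and [x - z], then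
     [(x - z)^2 <= 2 (x - y)^2 + 2 (y - z)^2]. *)
  have := sqr_ge0 (kappa * S * y - (x - z)).
  have := sqr_ge0 ((x - y) - (y - z)).
  move: h1; move: (kappa * S * y) ((1 - C) * y ^+ 2) => U W; nra.
have lower : 2 * Q - 3 * A - 3 * D <= \sum_i (c i + c (f i)) * (v i * v (f i)).
  have -> : 2 * Q - 3 * A - 3 * D = \sum_i (v i ^+ 2 + v (f i) ^+ 2
     - 3 / 2 * ((1 - c i) * v i ^+ 2 + (1 - c (f i)) * v (f i) ^+ 2)
     - 3 * (v i - v (f i)) ^+ 2).
    rewrite !sumrB -!mulr_sumr !big_split /=.
    rewrite (shift (fun i => (1 - c i) * v i ^+ 2)).
    by rewrite (shift (fun i => v i ^+ 2)) -/A -/D -/Q; field.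
  apply: ler_sum => i _.
  move: (c_le1 i) (c_le1 (f i)).
  move: (c i) (c (f i)) (v i) (v (f i)) => C C' x y C1 C1'.
  (* Twice the difference of the two sides is [d (2 a - t)^2 + (2 - d) (a - t)^2]. *)
  have half (a d t : R) : 0 <= d <= 2 ->
      d * (a * t) <= 3 / 2 * (d * a ^+ 2) + (a - t) ^+ 2.
    move=> /andP[d0 d2].
    have := mulr_ge0 d0 (sqr_ge0 (2 * a - t)).
    have : 0 <= (2 - d) * (a - t) ^+ 2 by rewrite mulr_ge0 ?sqr_ge0 //; lra.
    by lra.
  have /(half x _ y) : 0 <= 1 - C <= 2 by lra.
  have /(half y _ x) : 0 <= 1 - C' <= 2 by lra.
  by lra.
have : tau * (2 * Q - 3 * A - 3 * D) <= A + 2 * D.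
  apply: (le_trans (ler_wpM2l t0 lower)); apply: (le_trans _ upper).
  by rewrite mulr_sumr ler_sum // => i _; rewrite comm [leLHS]mulrA.
have t1 : tau <= 1 by nra.
(* Hence [2 tau Q <= 4 A + 5 D], so [tau Q / 10 <= A / 5 + D / 4]; the coefficient of [D] dictates
   the 10. *)
have : tau * (A + D) <= A + D by rewrite ler_piMl ?addr_ge0.
by lra.
Qed.

(** * The matrix as a cyclic operator *)

Lemma val_ordS n (i : 'I_n) : ordS i = (if i.+1 == n then 0 else i.+1) :> nat.
Proof.
rewrite /=; case: eqP => [->|ni]; first exact: modnn.
by rewrite modn_small //; have := ltn_ord i; lia.
Qed.

Lemma val_ord_pred n (i : 'I_n) :
  ord_pred i = (if i == 0 :> nat then n.-1 else i.-1) :> nat.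
Proof.
have := ltn_ord i; rewrite /=; case: eqP => [-> n0|i0 ltin].
  by rewrite modn_small; lia.
rewrite (_ : (i + n).-1 = i.-1 + n)%N; last lia.
by rewrite modnDr modn_small //; lia.
Qed.

(** A diagonal matrix plus two cyclic shifts; [3 <= n] keeps the three positions in each column
    distinct, so that no entries add up. *)
Lemma MxiE (R : realType) n xi (i j : 'I_n) : (3 <= n)%N ->
  Mxi R n xi i j = (i == j)%:R * (cos (2 * pi * xi%:~R * j%:R / n%:R) / 2)
    + (i == ordS j)%:R / 4 + (i == ord_pred j)%:R / 4.
Proof.
have eqE (x y : 'I_n) : (x == y) = (x == y :> nat) by [].
move=> n3; rewrite mxE !eqE val_ordS val_ord_pred.
have := ltn_ord i; have := ltn_ord j; move: (nat_of_ord i) (nat_of_ord j).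
move=> {}i {}j jn i_n.
case: (eqVneq i j) => [->|ij].
  have -> : (j == (if j.+1 == n then 0 else j.+1))%N = false.
    by apply/negbTE/eqP; case: ifP; lia.
  have -> : (j == (if j == 0 then n.-1 else j.-1))%N = false.
    by apply/negbTE/eqP; case: ifP; lia.
  by rewrite !mul0r !addr0 mul1r.
rewrite mul0r add0r; case: ifP => adj.
  have [->|iS] := eqVneq i (if j.+1 == n then 0 else j.+1)%N.
    rewrite (_ : (_ == _ :> nat) = false) ?mul0r ?addr0 //.
    by apply/negbTE/eqP; do 2 case: ifP; lia.
  rewrite (_ : (_ == _ :> nat)); first by rewrite mul0r add0r.
  by apply/eqP; move: iS adj; do 2 case: ifP; lia.
have -> : (i == (if j.+1 == n then 0 else j.+1))%N = false.
  by apply/negbTE/eqP; move: adj; case: ifP; lia.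
have -> : (i == (if j == 0 then n.-1 else j.-1))%N = false.
  by apply/negbTE/eqP; move: adj; case: ifP; lia.
by rewrite !mul0r addr0.
Qed.

Lemma Mxi_sym (R : realType) n xi : (Mxi R n xi)^T = Mxi R n xi.
Proof.
apply/matrixP => i j; rewrite !mxE eq_sym; case: eqP => [->//|_].
by congr (if _ then _ else _); do 2 case: eqP; do ?case: eqP; lia.
Qed.

Lemma sum_delta (R : nzRingType) (I : finType) (F : I -> R) j :
  \sum_i F i * (i == j)%:R = F j.
Proof.
rewrite (bigD1 j) //= eqxx mulr1 big1 ?addr0 // => i /negbTE->.
by rewrite mulr0.
Qed.

Lemma Mxi_form (R : realType) n xi (v : 'rV[R]_n) b : (3 <= n)%N ->
  v *m Mxi R n xi = b *: v ->
  b * \sum_j v 0 j ^+ 2 = \sum_(j < n)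
    (cos (2 * pi * xi%:~R * j%:R / n%:R) * v 0 j ^+ 2
      + v 0 j * v 0 (ordS j)) / 2.
Proof.
move=> n3 eig; pose c (j : 'I_n) := cos (2 * pi * xi%:~R * j%:R / n%:R : R).
have eigE j : b * v 0 j =
    v 0 j * (c j / 2) + v 0 (ordS j) / 4 + v 0 (ord_pred j) / 4.
  have := congr1 (fun w : 'rV_n => w 0 j) eig; rewrite !mxE => <-.
  rewrite -(sum_delta (fun i => v 0 i) j).
  rewrite -(sum_delta (fun i => v 0 i) (ordS j)).
  rewrite -(sum_delta (fun i => v 0 i) (ord_pred j)) !mulr_suml -!big_split /=.
  by apply: eq_bigr => i _; rewrite MxiE // /c; field.
have -> : b * \sum_j v 0 j ^+ 2 = \sum_j (c j / 2 * v 0 j ^+ 2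
    + v 0 j * v 0 (ordS j) / 4 + v 0 (ord_pred j) * v 0 j / 4).
  by rewrite mulr_sumr; apply: eq_bigr => j _; rewrite expr2 mulrA eigE; field.
(* Moved by one index, the predecessor term becomes a second copy of the successor term. *)
rewrite big_split /= [X in _ + X](reindex_inj (@ordS_inj n)) -big_split /=.
by apply: eq_bigr => j _; rewrite ordSK /c; field.
Qed.

(** Integrality of the frequency enters here: at the wrap-around the two angles differ by [k] full
    turns. *)
Lemma cos_sin_ordS (R : realType) n k (j : 'I_n) :
  let t := 2 * pi * k%:R / n%:R : R in
  cos (2 * pi * k%:R * (ordS j)%:R / n%:R) = cos (t * j%:R + t) /\
  sin (2 * pi * k%:R * (ordS j)%:R / n%:R) = sin (t * j%:R + t).
Proof.
move=> t; rewrite val_ordS; case: eqP => [jn|_]; last first.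
  have -> : 2 * pi * k%:R * j.+1%:R / n%:R = t * j%:R + t.
    by rewrite /t -natr1; ring.
  by [].
have -> : t * j%:R + t = 0 + (pi *+ 2) *+ k.
  have n0 : n%:R != 0 :> R by rewrite pnatr_eq0; lia.
  rewrite -[t in _ + t]mulr1 -mulrDr natr1 jn /t divfK // add0r.
  by rewrite mulr_natr -mulrnA mulr_natl -mulrnA mulnC mulrnA.
by rewrite mulr0 mul0r !periodicn //; [exact: sinD2pi|exact: cosD2pi].
Qed.

(** * The eigenvalue bound and the constant [theta] *)

Lemma Mxi_eigenvalue_le (R : realType) n k b : (3 <= n)%N ->
  0 <= sin (pi * (k%:R / n%:R)) :> R ->
  eigenvalue (Mxi R n k%:Z) b -> b <= 1 - sin (pi * (k%:R / n%:R)) / 10.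
Proof.
move=> n3 t0 /eigenvalueP[v /(Mxi_form n3) bE v0].
have Qpos : 0 < \sum_j v 0 j ^+ 2.
  rewrite lt_def row_sqr_eq0 v0 sumr_ge0 // => j _; exact: sqr_ge0.
rewrite -(ler_pM2r Qpos) bE.
pose x (j : 'I_n) : R := 2 * pi * k%:R * j%:R / n%:R.
set al := pi * _ in t0 *.
apply: (@spectral_gap R _ (@ordS n) (cos \o x) (sin \o x) (v 0) (cos al)) => //=.
- exact: ordS_inj.
- by move=> j; exact: cos2Dsin2.
- exact: cos2Dsin2.
move=> j; have [-> ->] := cos_sin_ordS R k j.
(* About the midpoint [m = x j + al], both sides equal [2 sin al cos al cos m]. *)
have -> : 2 * pi * k%:R / n%:R * j%:R + 2 * pi * k%:R / n%:R = x j + al + al.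
  by rewrite /x /al; ring.
have : cos al ^+ 2 + sin al ^+ 2 = 1 by exact: cos2Dsin2.
rewrite !(sinD, cosD).
move: (cos al) (sin al) (cos (x j)) (sin (x j)) => K T C S KT.
(* The isolated [S] and [C] are multiplied by [K^2 + T^2 = 1], which leaves a polynomial
   identity. *)
have {3}-> : S = S * (K ^+ 2 + T ^+ 2) by rewrite KT mulr1.
have {3}-> : C = C * (K ^+ 2 + T ^+ 2) by rewrite KT mulr1.
by ring.
Qed.

Theorem proposition3 (R : realType) :
  exists theta : R, 0 < theta /\
    forall (n : nat) (xi : int), (3 <= n)%N -> 1 <= xi ->
      xi%:~R <= n%:R / ln n%:R :> R ->
      exists beta : R, is_largest_eigenvalue (Mxi R n xi) beta /\
        beta <= 1 - theta * (xi%:~R / n%:R) `^ (4 / 3).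
Proof.
have ln3 : 1 < ln 3 :> R.
  by have := expR1_lt3 R; rewrite -ltr_ln ?posrE ?expR_gt0 // expRK.
have p0 := pi_gt0 R.
pose a : R := pi / ln 3.
have api : a < pi by rewrite /a ltr_pdivrMr; nra.
have a0 : 0 < a by apply: divr_gt0; lra.
have k0 : 0 < cos (a / 2) by apply: cos_gt0_pihalf; lra.
(* The slope of the linear lower bound for the sine on [[0, a]], times [pi], times the 1/10 of the
   spectral gap. *)
exists (cos (a / 2) ^+ 2 * pi / 10); split.
  by rewrite divr_gt0 // mulr_gt0 // exprn_gt0.
move=> n xi n3 xi1 xin.
have [b [eigb maxb]] : exists b, is_largest_eigenvalue (Mxi R n xi) b.
  by apply: sym_mx_largest_eigenvalue; [lia|exact: Mxi_sym].
exists b; split=> //.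
case: xi xi1 xin eigb {maxb} => // k k1 xin eigb.
have k1' : 1 <= k%:R :> R by rewrite ler1n; lia.
have n0 : 0 < n%:R :> R by rewrite ltr0n; lia.
have lnn : ln 3 <= ln n%:R :> R by rewrite ler_ln ?posrE // ler_nat.
have r0 : 0 < k%:R / n%:R :> R by rewrite divr_gt0 //; lra.
have rle : k%:R / n%:R <= (ln 3)^-1 :> R.
  rewrite ler_pdivrMr // (le_trans xin) // mulrC ler_wpM2r ?(ltW n0) //.
  by rewrite lef_pV2 ?posrE //; lra.
have r1 : k%:R / n%:R <= 1 :> R by rewrite (le_trans rle) // invf_le1; lra.
have xa : 0 <= pi * (k%:R / n%:R : R) <= a.
  apply/andP; split; first exact: mulr_ge0 (ltW p0) (ltW r0).
  by rewrite /a ler_pM2l.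
have sge := sin_ge_lin xa api.
have s0 : 0 <= sin (pi * (k%:R / n%:R)) :> R.
  by apply: le_trans sge; rewrite mulr_ge0 ?sqr_ge0 //; case/andP: xa.
apply: le_trans (Mxi_eigenvalue_le n3 s0 eigb) _.
have : (k%:R / n%:R) `^ (4 / 3) <= k%:R / n%:R :> R.
  by apply: ge1r_powR; [rewrite r0|lra].
have : 0 <= cos (a / 2) ^+ 2 * pi by rewrite mulr_ge0 ?sqr_ge0 // ltW.
rewrite -pmulrn; move: sge; rewrite mulrA.
move: (cos (a / 2) ^+ 2 * pi) (_ `^ _) (@sin R _) => K P S.
move: (k%:R / _) => r sge K0 Pr; have := ler_wpM2l K0 Pr; lra.
Qed.
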